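(* Let $Z$ be a finite-dimensional $JC^*$-triple system spanned by a hermitian grid $\{u_{ij}:1\le i,j\le n\}$. Then $T^*(Z)$ is TRO-isomorphic to $\mathbb{M}_n$.
   Context: $\mathbb{M}_n$ denotes the complex $n\times n$-matrices. A $JC^*$-triple system is a closed subspace of a $C^*$-algebra invariant under $\{a,b,c\}=\frac12(ab^*c+cb^*a)$; a $JB^*$-triple homomorphism is a linear map preserving the triple product. A tripotent is an element $e$ with $\{e,e,e\}=e$. A hermitian grid is a family $\{u_{ij}:i,j\in I\}$ of non-zero tripotents in $Z$ such that for all $i,j,k,l\in I$: (HG1) $u_{ij}=u_{ji}$. (HG2) $\{u_{kl},u_{kl},u_{ij}\}=0$ if $\{i,j\}\cap\{k,l\}=\emptyset$. (HG3) $\{u_{ii},u_{ii},u_{ij}\}=\frac12u_{ij}$ and $\{u_{ij},u_{ij},u_{ii}\}=u_{ii}$ if $i\ne j$. (HG4) $\{u_{ij},u_{ij},u_{jk}\}=\frac12u_{jk}$ and $\{u_{jk},u_{jk},u_{ij}\}=\frac12u_{ij}$ if $i,j,k$ are pairwise distinct. (HG5) $\{u_{ij},u_{jk},u_{kl}\}=\frac12u_{il}$ if $i\neq l$ and at least two of these three tripotents are distinct. (HG6) $\{u_{ij},u_{jk},u_{ki}\}=u_{ii}$ if at least two of these three tripotents are distinct. (HG7) All other triple products of elements of the grid (apart from $\{u_{ij},u_{ij},u_{ij}\}=u_{ij}$) are $0$. A TRO is a closed subspace $T\subseteq B(H)$, $H$ a Hilbert space, with $xy^*z\in T$ for all $x,y,z\in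 T$; it carries the triple product $\frac12(xy^*z+zy^*x)$. TRO-homomorphisms are linear maps preserving $xy^*z$. The universal enveloping TRO of $Z$ is the TRO $T^*(Z)$, unique up to TRO-isomorphism, with a $JB^*$-triple homomorphism $\rho_Z:Z\to T^*(Z)$ such that $\rho_Z(Z)$ generates $T^*(Z)$ as a TRO and every $JB^*$-triple homomorphism $\alpha:Z\to T$ into a TRO $T$ factors as $\alpha=T^*(\alpha)\circ\rho_Z$ with $T^*(\alpha):T^*(Z)\to T$ a TRO-homomorphism. *)

(* Defs.v *)
From HB Require Import structures.
From mathcomp Require Import all_boot all_order all_algebra.
From mathcomp Require Import complex.
From mathcomp Require Import all_classical all_reals all_analysis.

Set Implicit Arguments.
Unset Strict Implicit.
Unset Printing Implicit Defensive.

Import Order.TTheory GRing.Theory Num.Theory.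
Import numFieldNormedType.Exports.

Local Open Scope classical_set_scope.
Local Open Scope ring_scope.

(* C*-algebras are not assumed to be unital, which is why the product is not
   the one of a MathComp ring structure. The norm takes its (real, nonnegative)
   values in R[i]. *)
HB.mixin Record CompleteNormedModule_isCStarAlgebra (R : realType) A
    of CompleteNormedModule R[i] A := {
  cmul : A -> A -> A ;
  star : A -> A ;
  cmul_linearl : forall y (a : R[i]) x x',
    cmul (a *: x + x') y = a *: cmul x y + cmul x' y ;
  cmul_linearr : forall x (a : R[i]) y y',
    cmul x (a *: y + y') = a *: cmul x y + cmul x y' ;
  cmulA : associative cmul ;
  star_antilinear : forall (a : R[i]) x y,
    star (a *: x + y) = a^* *: star x + star y ;
  starK : involutive star ;
  starM : forall x y, star (cmul x y) = cmul (star y) (star x) ;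
  norm_cmul_le : forall x y, `|cmul x y| <= `|x| * `|y| ;
  norm_cstar : forall x, `|cmul (star x) x| = `|x| ^+ 2
}.

#[short(type="cstarAlgType")]
HB.structure Definition CStarAlgebra (R : realType) :=
  {A of CompleteNormedModule_isCStarAlgebra R A & CompleteNormedModule R[i] A}.

(* The inner product is linear in its first argument and antilinear in its
   second one. *)
HB.mixin Record CompleteNormedModule_isHilbert (R : realType) H
    of CompleteNormedModule R[i] H := {
  inner : {dot H for (Num.conj : R[i] -> R[i])} ;
  norm_inner : forall x : H, `|x| ^+ 2 = inner x x
}.

#[short(type="hilbertType")]
HB.structure Definition Hilbert (R : realType) :=
  {H of CompleteNormedModule_isHilbert R H & CompleteNormedModule R[i] H}.

Section Linear.
Context {K : fieldType}.

Definition is_subspace {V : lmodType K} (S : set V) : Prop :=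
  S 0 /\ forall (a : K) x y, S x -> S y -> S (a *: x + y).

Definition lin_span {V : lmodType K} {I : finType} (b : I -> V) : set V :=
  [set x | exists c : I -> K, x = \sum_i c i *: b i].

Definition finite_dimensional {V : lmodType K} (S : set V) : Prop :=
  exists (m : nat) (b : 'I_m -> V), S = lin_span b.

(* [ternary_hom t S t' S' f]: f restricts to a linear map from S to S' that
   carries the ternary operation t to t'; the values of f outside of S are
   irrelevant. *)
Definition ternary_hom {V W : lmodType K} (t : V -> V -> V -> V) (S : set V)
    (t' : W -> W -> W -> W) (S' : set W) (f : V -> W) : Prop :=
  [/\ forall x, S x -> S' (f x),
      forall (a : K) x y, S x -> S y -> f (a *: x + y) = a *: f x + f y
    & forall x y z, S x -> S y -> S z -> f (t x y z) = t' (f x) (f y) (f z)].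

Definition ternary_isomorphic {V W : lmodType K} (t : V -> V -> V -> V)
    (S : set V) (t' : W -> W -> W -> W) (S' : set W) : Prop :=
  exists f : V -> W, ternary_hom t S t' S' f /\ set_bij S S' f.

Definition jordan_triple {V : lmodType K} (t : V -> V -> V -> V) (x y z : V) :=
  2^-1 *: (t x y z + t z y x).

End Linear.

Section Triples.
Context {R : realType}.

Definition cstar_ternary {A : cstarAlgType R} (x y z : A) : A :=
  cmul (cmul x (star y)) z.

Definition is_JCstar_triple {A : cstarAlgType R} (Z : set A) : Prop :=
  [/\ is_subspace Z, closed Z &
      forall x y z, Z x -> Z y -> Z z -> Z (jordan_triple cstar_ternary x y z)].

(* B(H), as a set of functions; H -> H carries the pointwise linear
   structure. *)
Definition bounded_op {H : hilbertType R} : set (H -> H) :=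
  [set f | linear f /\ continuous f].

(* The adjoint of a bounded operator exists and is unique by the Riesz
   representation theorem. *)
Definition adjoint {H : hilbertType R} (f : H -> H) : H -> H :=
  xget 0 [set g | bounded_op g /\
                  forall x y, inner (f x) y = inner x (g y)].

Definition op_ternary {H : hilbertType R} (x y z : H -> H) : H -> H :=
  x \o adjoint y \o z.

(* closedness in B(H) for the operator norm *)
Definition op_norm_closed {H : hilbertType R} (T : set (H -> H)) : Prop :=
  forall f, bounded_op f ->
    (forall e : R[i], 0 < e ->
       exists2 g, T g & forall x, `|f x - g x| <= e * `|x|) ->
    T f.

Definition is_TRO {H : hilbertType R} (T : set (H -> H)) : Prop :=
  [/\ T `<=` bounded_op, is_subspace T, op_norm_closed T &
      forall x y z, T x -> T y -> T z -> T (op_ternary x y z)].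

Definition TRO_generated {H : hilbertType R} (G : set (H -> H)) :
  set (H -> H) := smallest is_TRO G.

Definition JBstar_hom {A : cstarAlgType R} (Z : set A) {H : hilbertType R}
    (T : set (H -> H)) (f : A -> H -> H) : Prop :=
  ternary_hom (jordan_triple cstar_ternary) Z (jordan_triple op_ternary) T f.

Definition TRO_hom {H H' : hilbertType R} (T : set (H -> H))
    (T' : set (H' -> H')) (f : (H -> H) -> (H' -> H')) : Prop :=
  ternary_hom op_ternary T op_ternary T' f.

Definition is_universal_TRO {A : cstarAlgType R} (Z : set A)
    {H : hilbertType R} (T : set (H -> H)) (rho : A -> H -> H) : Prop :=
  [/\ is_TRO T, JBstar_hom Z T rho, TRO_generated (rho @` Z) = T &
      forall (H' : hilbertType R) (T' : set (H' -> H')) (alpha : A -> H' -> H'),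
        is_TRO T' -> JBstar_hom Z T' alpha ->
        exists2 Talpha : (H -> H) -> (H' -> H'),
          TRO_hom T T' Talpha & forall x, Z x -> alpha x = Talpha (rho x)].

Definition mx_ternary {n : nat} (x y z : 'M[R[i]]_n) : 'M[R[i]]_n :=
  x *m (map_mx Num.conj y)^T *m z.

Definition TRO_iso_matrices {H : hilbertType R} (T : set (H -> H)) (n : nat) :=
  ternary_isomorphic op_ternary T (@mx_ternary n) setT.

End Triples.

Section HermitianGrid.
Context {K : fieldType} {V : lmodType K} (t : V -> V -> V -> V).
Context {I : Type} (u : I -> I -> V).

(* The triples of grid elements whose product is prescribed by one of the
   axioms other than the last one. The triple product is symmetric in its outer
   variables, so both orders count as prescribed. *)
Inductive grid_prescribed : V -> V -> V -> Prop :=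
| prescribed_cube i j : grid_prescribed (u i j) (u i j) (u i j)
| prescribed_HG2 i j k l : i <> k -> i <> l -> j <> k -> j <> l ->
    grid_prescribed (u k l) (u k l) (u i j)
| prescribed_HG3 i j : i <> j -> grid_prescribed (u i i) (u i i) (u i j)
| prescribed_HG3' i j : i <> j -> grid_prescribed (u i j) (u i j) (u i i)
| prescribed_HG4 i j k : i <> j -> j <> k -> i <> k ->
    grid_prescribed (u i j) (u i j) (u j k)
| prescribed_HG4' i j k : i <> j -> j <> k -> i <> k ->
    grid_prescribed (u j k) (u j k) (u i j)
| prescribed_HG5 i j k l : i <> l ->
    ~ (u i j = u j k /\ u j k = u k l) ->
    grid_prescribed (u i j) (u j k) (u k l)
| prescribed_HG6 i j k : ~ (u i j = u j k /\ u j k = u k i) ->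
    grid_prescribed (u i j) (u j k) (u k i)
| prescribed_outer x y z : grid_prescribed x y z -> grid_prescribed z y x.

Record hermitian_grid (Z : set V) : Prop := HermitianGrid {
  grid_mem : forall i j, Z (u i j) ;
  grid_neq0 : forall i j, u i j <> 0 ;
  grid_tripotent : forall i j, t (u i j) (u i j) (u i j) = u i j ;
  grid_HG1 : forall i j, u i j = u j i ;
  grid_HG2 : forall i j k l, i <> k -> i <> l -> j <> k -> j <> l ->
    t (u k l) (u k l) (u i j) = 0 ;
  grid_HG3 : forall i j, i <> j ->
    t (u i i) (u i i) (u i j) = 2^-1 *: u i j /\
    t (u i j) (u i j) (u i i) = u i i ;
  grid_HG4 : forall i j k, i <> j -> j <> k -> i <> k ->
    t (u i j) (u i j) (u j k) = 2^-1 *: u j k /\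
    t (u j k) (u j k) (u i j) = 2^-1 *: u i j ;
  grid_HG5 : forall i j k l, i <> l ->
    ~ (u i j = u j k /\ u j k = u k l) ->
    t (u i j) (u j k) (u k l) = 2^-1 *: u i l ;
  grid_HG6 : forall i j k, ~ (u i j = u j k /\ u j k = u k i) ->
    t (u i j) (u j k) (u k i) = u i i ;
  grid_HG7 : forall i j k l p q,
    ~ grid_prescribed (u i j) (u k l) (u p q) ->
    t (u i j) (u k l) (u p q) = 0
}.

End HermitianGrid.

(* Main.v *)
Require Import Defs.
From HB Require Import structures.
From mathcomp Require Import all_boot all_order all_algebra.
From mathcomp Require Import complex spectral.
From mathcomp Require Import all_classical all_reals all_analysis.
From mathcomp Require Import ring.

(* Write [x y z] for x y^* z. In a *-algebra, the relations of a hermitian grid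
   w force the elements e_ij = [w_ii w_ii w_ij] to be matrix units,
   [e_ij e_kl e_pq] = e_iq if j = l and k = p, and 0 otherwise, and
   w_ij = e_ij + e_ji for i <> j. Applied in the C*-algebra containing Z, this
   realizes Z as the symmetric matrices inside a copy of M_n, hence as operators
   on l2^n. Applied to the image of the grid in a TRO T, it extends the given
   homomorphism to all of M_n, which is the universal property.
   For an arbitrary universal TRO, the span of its matrix units is already a TRO
   (closed for the operator norm because the matrix coefficients are bounded
   functionals), and the units do not vanish since the homomorphism to operators
   on l2^n factors through it. *)

Set Implicit Arguments.
Unset Strict Implicit.
Unset Printing Implicit Defensive.

Import Order.TTheory GRing.Theory Num.Theory.
Import numFieldNormedType.Exports.

Local Open Scope classical_set_scope.
Local Open Scope ring_scope.

(** * Matrix units from a hermitian grid *)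

(** The product and the involution are parameters, so that one theory serves both the C*-algebra
    containing Z and the adjointable operators under composition. *)
Record star_algebra (C : numClosedFieldType) (V : lmodType C)
    (mul : V -> V -> V) (star : V -> V) : Prop := StarAlgebra {
  sa_mulA : associative mul ;
  sa_mul_linearl : forall y (a : C) x x',
    mul (a *: x + x') y = a *: mul x y + mul x' y ;
  sa_mul_linearr : forall x (a : C) y y',
    mul x (a *: y + y') = a *: mul x y + mul x y' ;
  sa_star_antilinear : forall (a : C) x y,
    star (a *: x + y) = a^* *: star x + star y ;
  sa_starK : involutive star ;
  sa_starM : forall x y, star (mul x y) = mul (star y) (star x)
}.

Definition star_ternary (V : Type) (mul : V -> V -> V) (star : V -> V) x y z :=
  mul (mul x (star y)) z.

Definition mx_ctranspose (C : numClosedFieldType) m n (M : 'M[C]_(m, n)) :=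
  (map_mx Num.conj M)^T.

Section StarAlgebraTheory.
Context {C : numClosedFieldType} {V : lmodType C}.
Context {mul : V -> V -> V} {star : V -> V}.
Hypothesis sa : star_algebra mul star.
Local Notation "x • y" := (mul x y) (at level 40, left associativity).
Local Notation "x †" := (star x)
  (at level 1, left associativity, format "x †").

Let mulA := sa_mulA sa.
Let starM := sa_starM sa.
Let starK := sa_starK sa.

Lemma sa_mulDl x y z : (x + y) • z = x • z + y • z.
Proof. by have := sa_mul_linearl sa z 1 x y; rewrite !scale1r. Qed.

Lemma sa_mulDr x y z : x • (y + z) = x • y + x • z.
Proof. by have := sa_mul_linearr sa x 1 y z; rewrite !scale1r. Qed.

Lemma sa_starD x y : (x + y)† = x† + y†.
Proof. by have := sa_star_antilinear sa 1 x y; rewrite rmorph1 !scale1r. Qed.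

Lemma sa_mul0x x : 0 • x = 0.
Proof. by apply: (addrI (0 • x)); rewrite -sa_mulDl !addr0. Qed.

Lemma sa_mulx0 x : x • 0 = 0.
Proof. by apply: (addrI (x • 0)); rewrite -sa_mulDr !addr0. Qed.

Lemma sa_star0 : 0† = 0.
Proof. by apply: (addrI (0†)); rewrite -sa_starD !addr0. Qed.

Lemma sa_mulZl a x y : (a *: x) • y = a *: (x • y).
Proof. by have := sa_mul_linearl sa y a x 0; rewrite sa_mul0x !addr0. Qed.

Lemma sa_mulZr a x y : x • (a *: y) = a *: (x • y).
Proof. by have := sa_mul_linearr sa x a y 0; rewrite sa_mulx0 !addr0. Qed.

Lemma sa_starZ a x : (a *: x)† = a^* *: x†.
Proof. by have := sa_star_antilinear sa a x 0; rewrite sa_star0 !addr0. Qed.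

Lemma sa_mul_suml I (r : seq I) (P : pred I) (F : I -> V) y :
  (\sum_(i <- r | P i) F i) • y = \sum_(i <- r | P i) F i • y.
Proof.
exact: (big_morph (mul^~ y) (fun a b => sa_mulDl a b y) (sa_mul0x y)).
Qed.

Lemma sa_mul_sumr I (r : seq I) (P : pred I) (F : I -> V) x :
  x • (\sum_(i <- r | P i) F i) = \sum_(i <- r | P i) x • F i.
Proof. exact: (big_morph (mul x) (sa_mulDr x) (sa_mulx0 x)). Qed.

Lemma sa_star_sum I (r : seq I) (P : pred I) (F : I -> V) :
  (\sum_(i <- r | P i) F i)† = \sum_(i <- r | P i) (F i)†.
Proof. exact: (big_morph star sa_starD sa_star0). Qed.

(* The Peirce-zero relation {p, p, v} = 0 splits into its two halves because
   left multiplication by p and right multiplication by q commute. *)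
Lemma peirce0_split p q v :
  p • p = p -> q • q = q -> p • v + v • q = 0 -> p • v = 0 /\ v • q = 0.
Proof.
move=> pp qq pvq.
have pv : p • v = - (p • v • q).
  apply/eqP; rewrite -addr_eq0 -{1}pp -mulA -mulA -sa_mulDr pvq.
  by rewrite sa_mulx0.
have vq : v • q = - (p • v • q).
  apply/eqP; rewrite -addr_eq0 addrC -{2}qq mulA -sa_mulDl pvq.
  by rewrite sa_mul0x.
have e : p • v = v • q by rewrite vq.
move: pvq; rewrite -e -mulr2n => /eqP; rewrite -scaler_nat scaler_eq0.
by rewrite pnatr_eq0 => /eqP.
Qed.

(** Consequences of the grid axioms for the associative product, with the factors 1/2 cleared. The
    pattern excluded from [grid_chain] is the one where the three factors coincide, and where the
    sum would be twice w_ij. *)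
Record grid_relations (I : eqType) (w : I -> I -> V) : Prop := GridRelations {
  gridC : forall i j, w i j = w j i ;
  grid_cube : forall i j, w i j • (w i j)† • w i j = w i j ;
  grid_orth : forall i j, i != j ->
    w i i • (w i i)† • w j j + w j j • (w i i)† • w i i = 0 ;
  grid_half : forall i j, i != j ->
    w i i • (w i i)† • w i j + w i j • (w i i)† • w i i = w i j ;
  grid_chain : forall i j k l, i != l -> ~~ ((k == i) && (l == j)) ->
    w i j • (w j k)† • w k l + w k l • (w j k)† • w i j = w i l ;
  grid_loop : forall i j, i != j -> w i j • (w j j)† • w j i = w i i
}.

(** Non-vanishing is left out on purpose: a homomorphism may kill the grid, and its units are then
    all 0. *)
Definition matrix_units (I : eqType) (e : I -> I -> V) : Prop :=
  forall i j k l p q, star_ternary mul star (e i j) (e k l) (e p q) =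
    if (j == l) && (k == p) then e i q else 0.

Section Units.
Context {I : eqType} {w : I -> I -> V}.
Hypothesis gw : grid_relations w.

(* The locks keep reassociation from looking into these products. *)
Definition grid_unit i j := locked (w i i • (w i i)† • w i j).
Local Notation e := grid_unit.
(** Final and initial projections of the partial isometry w_ii. *)
Let p i := locked (w i i • (w i i)†).
Let q i := locked ((w i i)† • w i i).

Let pE i : p i = w i i • (w i i)†. Proof. by rewrite /p -lock. Qed.
Let qE i : q i = (w i i)† • w i i. Proof. by rewrite /q -lock. Qed.

Lemma grid_unitE i j : e i j = w i i • (w i i)† • w i j.
Proof. by rewrite /grid_unit -lock. Qed.

Let eE i j : e i j = p i • w i j. Proof. by rewrite grid_unitE pE. Qed.
Let pst i : (p i)† = p i. Proof. by rewrite pE starM starK. Qed.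
Let qst i : (q i)† = q i. Proof. by rewrite qE starM starK. Qed.
Let pw_diag i : p i • w i i = w i i.
Proof. by rewrite pE (grid_cube gw). Qed.
Let wq_diag i : w i i • q i = w i i.
Proof. by rewrite qE mulA (grid_cube gw). Qed.
Let pp i : p i • p i = p i. Proof. by rewrite {2 3}pE mulA pw_diag. Qed.
Let qq i : q i • q i = q i. Proof. by rewrite {1 3}qE -mulA wq_diag. Qed.

Let orth i j : i != j -> p i • w j j = 0 /\ w j j • q i = 0.
Proof.
move=> ij; apply: peirce0_split => //.
by rewrite -(grid_orth gw ij) pE qE !mulA.
Qed.

Let pp0 i j : i != j -> p i • p j = 0.
Proof. by move=> ij; rewrite [p j]pE mulA (orth ij).1 sa_mul0x. Qed.

Let qq0 i j : i != j -> q i • q j = 0.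
Proof.
by rewrite eq_sym => ij; rewrite [q i]qE -mulA (orth ij).2 sa_mulx0.
Qed.

Let half i j : i != j -> w i j = p i • w i j + w i j • q i.
Proof. by move=> ij; rewrite -{1}(grid_half gw ij) pE qE !mulA. Qed.

Let half' i j : i != j -> w i j = p j • w i j + w i j • q j.
Proof. by rewrite eq_sym => ij; rewrite (gridC gw i j) -half. Qed.

(** Multiplying [half'] by p_i on the left kills p_j w_ij, and multiplying [half] by q_j on the
    right kills w_ij q_i. Thus p_i w_ij and w_ij q_j are the same corner p_i w_ij q_j, which is
    e_ij. *)
Let pwq i j : i != j -> p i • w i j = p i • w i j • q j.
Proof.
move=> ij; have /(congr1 (mul (p i))) := half' ij.
by rewrite sa_mulDr !mulA pp0// sa_mul0x add0r.
Qed.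

Let wq i j : i != j -> w i j • q j = p i • w i j • q j.
Proof.
move=> ij; have /(congr1 (mul^~ (q j))) := half ij.
by rewrite /= sa_mulDl -[_ • q i • q j]mulA qq0// sa_mulx0 addr0.
Qed.

Let wqE i j : w i j • q j = e i j.
Proof.
have [->|ij] := eqVneq i j; first by rewrite wq_diag eE pw_diag.
by rewrite eE pwq// wq.
Qed.

Let pe i j : p i • e i j = e i j. Proof. by rewrite eE mulA pp. Qed.
Let eqr i j : e i j • q j = e i j.
Proof. by rewrite -wqE -mulA qq. Qed.

Let diagE i : w i i = e i i. Proof. by rewrite eE pw_diag. Qed.

Lemma grid_unitD i j : i != j -> w i j = e i j + e j i.
Proof.
by move=> ij; rewrite {1}(half ij) -eE (gridC gw i j) wqE.
Qed.

Let pe0 i k j : i != k -> p i • e k j = 0.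
Proof. by move=> ik; rewrite -pe mulA pp0// sa_mul0x. Qed.

Let eq0 i j k : j != k -> e i j • q k = 0.
Proof. by move=> jk; rewrite -eqr -mulA qq0// sa_mulx0. Qed.

Let ees0 i j k l : j != l -> e i j • (e k l)† = 0.
Proof.
by move=> jl; rewrite -[e k l]eqr starM qst mulA eq0// sa_mul0x.
Qed.

Lemma grid_unit_orth i j k l : i != k -> (e i j)† • e k l = 0.
Proof. by move=> ik; rewrite -[e i j]pe starM pst -mulA pe0// sa_mulx0. Qed.

Let ews i j k : e i j • (w j k)† = e i j • (e k j)†.
Proof.
have [->|jk] := eqVneq j k; first by rewrite diagE.
by rewrite grid_unitD// sa_starD sa_mulDr (ees0 i j jk) add0r.
Qed.

(** Cutting down to the corner (p_i, q_l) turns a product of grid elements into one of units: the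
    outer factors become e_ij and e_kl, and only the summand e_kj of w_jk then meets e_ij. *)
Let compress i j k l : p i • (w i j • (w j k)† • w k l) • q l =
  e i j • (e k j)† • e k l.
Proof. by rewrite -!mulA wqE !mulA -eE ews. Qed.

Let pw0 i j k : i != j -> i != k -> p i • w j k = 0.
Proof.
move=> ij ik; have [<-|jk] := eqVneq j k; first by rewrite diagE pe0.
by rewrite grid_unitD// sa_mulDr !pe0// addr0.
Qed.

Let wq0 i j k : k != i -> k != j -> w i j • q k = 0.
Proof.
move=> ki kj; have [->|ij] := eqVneq i j.
  by rewrite diagE eq0// eq_sym.
by rewrite grid_unitD// sa_mulDl !eq0 1?eq_sym// addr0.
Qed.

Let mu_neq i j k l : i != l -> e i j • (e k j)† • e k l = e i l.
Proof.
move=> il; rewrite -compress.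
have [/andP[/eqP -> /eqP ->]|nkl] := boolP ((k == i) && (l == j)).
  by rewrite (gridC gw j i) (grid_cube gw) -mulA wqE pe.
have /(congr1 (fun x => p i • x • q l)) := grid_chain gw il nkl.
rewrite sa_mulDr sa_mulDl -[p i • w i l • _]mulA wqE pe => <-.
(* The reversed product of [grid_chain] has no component in this corner: if k = i then l differs
   from i and j, so q_l kills w_ij; otherwise p_i kills w_kl. *)
rewrite [X in _ = _ + X](_ : _ = 0) ?addr0//.
have [ki|ki] := eqVneq k i.
  have lj : l != j by rewrite ki eqxx in nkl.
  by rewrite -!mulA wq0 ?sa_mulx0// eq_sym.
by rewrite !mulA pw0 ?sa_mul0x// eq_sym.
Qed.

Let mu_loop i j : e i j • (e j j)† • e j i = e i i.
Proof.
rewrite -compress; have [->|ij] := eqVneq i j.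
  by rewrite (grid_cube gw) -mulA wqE pe.
by rewrite (grid_loop gw ij) -mulA wqE pe.
Qed.

(** What remains is i = l. For i = j and k != i, the factor e_ii is expanded as e_ik e_kk^* e_ki;
    for i != j, the factor e_ki is expanded as e_kj e_jj^* e_ji. Reassociating leaves only products
    covered by [mu_neq] and [mu_loop]. *)
Let mu i j k l : e i j • (e k j)† • e k l = e i l.
Proof.
have [<-|] := eqVneq i l; last exact: mu_neq.
have ekij : e k j • (e j j)† • e j i = e k i.
  by have [->|ki] := eqVneq k i; [exact: mu_loop | exact: mu_neq].
have [ij|ij] := eqVneq i j.
  have [->|ki] := eqVneq k i; first by rewrite -ij mu_loop.
  rewrite -ij -{1}(mu_loop i k) -!mulA [X in _ • (_ • X)]mulA mu_neq//.
  by rewrite mulA mu_loop.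
by rewrite -ekij !mulA mu_neq// mu_loop.
Qed.

Lemma grid_unitsP : matrix_units e.
Proof.
move=> i j k l a b; rewrite /star_ternary.
have [<-|jl] := eqVneq j l; last by rewrite ees0// sa_mul0x.
have [<-|ka] := eqVneq k a; first exact: mu.
by rewrite -mulA grid_unit_orth// sa_mulx0.
Qed.

Lemma grid_unit_diag i : e i i = w i i. Proof. by rewrite diagE. Qed.
End Units.

(** * Elements with prescribed matrix coefficients *)

Section MatrixElements.
Context {n : nat} {e : 'I_n -> 'I_n -> V}.
Hypothesis mu : matrix_units e.

Definition mx_elt (e : 'I_n -> 'I_n -> V) (M : 'M[C]_n) :=
  \sum_i \sum_j M i j *: e i j.

Lemma mx_elt_linear : linear (mx_elt e).
Proof.
move=> a M N; rewrite /mx_elt scaler_sumr -big_split; apply: eq_bigr => i _.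
rewrite scaler_sumr -big_split; apply: eq_bigr => j _.
by rewrite !mxE scalerDl scalerA.
Qed.

Lemma mx_eltZ a M : mx_elt e (a *: M) = a *: mx_elt e M.
Proof.
have m0 : mx_elt e 0 = 0.
  by apply: big1 => i _; apply: big1 => j _; rewrite mxE scale0r.
by have := mx_elt_linear a M 0; rewrite m0 !addr0.
Qed.

Lemma mx_elt0 : mx_elt e 0 = 0.
Proof. by have := mx_eltZ 0 0; rewrite !scale0r. Qed.

Lemma mx_eltD M N : mx_elt e (M + N) = mx_elt e M + mx_elt e N.
Proof. by have := mx_elt_linear 1 M N; rewrite !scale1r. Qed.

Lemma mx_elt_sum (J : finType) (F : J -> 'M[C]_n) :
  mx_elt e (\sum_i F i) = \sum_i mx_elt e (F i).
Proof.
exact: (big_morph (mx_elt e) mx_eltD mx_elt0).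
Qed.

Lemma mx_elt_delta i j : mx_elt e (delta_mx i j) = e i j.
Proof.
rewrite /mx_elt (bigD1 i)//= (bigD1 j)//= mxE !eqxx scale1r.
rewrite !big1 ?addr0// => [k ki|k kj].
  by apply: big1 => l _; rewrite mxE (negbTE ki) scale0r.
by rewrite mxE (negbTE kj) andbF scale0r.
Qed.

(** Expanding gives a sum over six indices. The unit relations collapse the row index of z onto that
    of y, and the column index of y onto that of x; what is left is the entrywise formula for x y^*
    z. *)
Lemma mx_elt_ternary x y z :
  star_ternary mul star (mx_elt e x) (mx_elt e y) (mx_elt e z) =
  mx_elt e (x *m mx_ctranspose y *m z).
Proof.
have row (i : 'I_n) : \sum_j x i j *: e i j • (mx_elt e y)† • mx_elt e z =
    \sum_q (x *m mx_ctranspose y *m z) i q *: e i q.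
  transitivity (\sum_j \sum_k \sum_q
      ((x i j * (y k j)^* * z k q) *: e i q)).
    apply: eq_bigr => j _.
    rewrite sa_star_sum sa_mul_sumr sa_mul_suml; apply: eq_bigr => k _.
    rewrite sa_star_sum sa_mul_sumr sa_mul_suml.
    transitivity (\sum_l \sum_q if j == l then
       (x i j * (y k l)^* * z k q) *: e i q else 0).
      apply: eq_bigr => l _; rewrite sa_mul_sumr (bigD1 k)//=.
      rewrite [X in _ + X]big1 ?addr0.
        rewrite sa_mul_sumr; apply: eq_bigr => q _.
        rewrite sa_starZ !(sa_mulZl, sa_mulZr) !scalerA.
        have := mu i j k l k q; rewrite /star_ternary eqxx andbT => ->.
        by case: ifP => _; rewrite ?scaler0//; congr (_ *: _); ring.
      move=> p pk; rewrite sa_mul_sumr big1// => q _.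
      rewrite sa_starZ !(sa_mulZl, sa_mulZr).
      have := mu i j k l p q; rewrite /star_ternary.
      rewrite [k == p]eq_sym (negbTE pk) andbF => ->.
      by rewrite !scaler0.
    rewrite (bigD1 j)//= eqxx [X in _ + X]big1 ?addr0// => l.
    by rewrite eq_sym => /negbTE ->; rewrite big1.
  rewrite exchange_big/=; under eq_bigr do rewrite exchange_big/=.
  rewrite exchange_big/=; apply: eq_bigr => q _; rewrite mxE scaler_suml.
  apply: eq_bigr => k _; rewrite !mxE mulr_suml scaler_suml.
  by apply: eq_bigr => j _; rewrite !mxE.
rewrite {1}/mx_elt /star_ternary !sa_mul_suml; apply: eq_bigr => i _.
by rewrite -row !sa_mul_suml; apply: eq_bigr.
Qed.

Lemma mx_ctranspose_delta m p (i : 'I_m) (j : 'I_p) :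
  mx_ctranspose (delta_mx i j : 'M[C]_(m, p)) = delta_mx j i.
Proof. by rewrite /mx_ctranspose map_delta_mx trmx_delta. Qed.

Lemma mul_delta_mx_delta m p (M : 'M[C]_(m, p)) i j (k l : 'I_n) :
  delta_mx k i *m M *m delta_mx j l = M i j *: delta_mx k l.
Proof.
apply/matrixP => a b; rewrite !mxE (bigD1 j)//= big1 => [|c cj]; last first.
  by rewrite [delta_mx _ _ _ _]mxE (negbTE cj) mulr0.
rewrite addr0 mxE (bigD1 i)//= big1 => [|c ci]; last first.
  by rewrite mxE (negbTE ci) andbF mul0r.
rewrite addr0 !mxE !eqxx andbT.
by case: (a == k); rewrite ?mul1r// !mul0r mulr0.
Qed.

(** A coefficient is read off by ternary products with units. This yields both the independence of
    the units and the boundedness of the coefficient functionals. *)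
Lemma mx_elt_compress M i j :
  star_ternary mul star
    (star_ternary mul star (e i i) (e i i) (mx_elt e M)) (e i j) (e i i) =
  M i j *: e i i.
Proof.
rewrite -(mx_elt_delta i j) -(mx_elt_delta i i) !mx_elt_ternary.
rewrite !mx_ctranspose_delta mul_delta_mx mul_delta_mx_delta -scalemxAl.
by rewrite mul_delta_mx mx_eltZ mx_elt_delta.
Qed.

Lemma mx_elt_inj : (forall i, e i i != 0) -> injective (mx_elt e).
Proof.
move=> e0; suff ker M : mx_elt e M = 0 -> M = 0.
  move=> M N MN; apply/eqP; rewrite -subr_eq0; apply/eqP/ker.
  have := mx_elt_linear (- 1) N M; rewrite MN !scaleN1r addNr => NM.
  by rewrite addrC.
move=> M0; apply/matrixP => i j; rewrite mxE.
have := mx_elt_compress M i j; rewrite M0 /star_ternary sa_mulx0 !sa_mul0x.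
by move/esym/eqP; rewrite scaler_eq0 (negbTE (e0 i)) orbF => /eqP.
Qed.
End MatrixElements.
End StarAlgebraTheory.

(** * Adjointable operators *)

Section AdjointableOperators.
Context {R : realType} {H : hilbertType R}.
Implicit Types (f g : H -> H) (x y : H).

Lemma innerC x y : inner x y = (inner y x)^*.
Proof. by rewrite hermC mul1r. Qed.

Lemma inner_eq0 x : inner x x = 0 -> x = 0.
Proof.
by rewrite -norm_inner => /eqP; rewrite expf_eq0/= normr_eq0 => /eqP.
Qed.

Lemma inner_injr x y : (forall z, inner z x = inner z y) -> x = y.
Proof.
move=> xy; apply/eqP; rewrite -subr_eq0; apply/eqP/inner_eq0.
by rewrite linearBr/= xy subrr.
Qed.

Lemma inner_le x y : `|inner x y| <= `|x| * `|y|.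
Proof.
have [->|y0] := eqVneq y 0; first by rewrite linear0r !normr0 mulr0.
have y2 : 0 < `|y| ^+ 2 by rewrite exprn_gt0// normr_gt0.
rewrite -(ler_pXn2r (n := 2))// ?nnegrE ?mulr_ge0// exprMn -ler_pdivrMr//.
(* Here [a *: y] is the orthogonal projection of x onto the line of y. Both a^* (x, y) and |a|^2
   |y|^2 equal t = |(x, y)|^2 / |y|^2, so the expanded square is |x|^2 - t. *)
set a := inner x y / `|y| ^+ 2.
have : 0 <= `|x - a *: y| ^+ 2 by rewrite exprn_ge0.
rewrite norm_inner dnormB dnormZ linearZr_LR/= -!norm_inner.
set t := _ / _; have at_ : a^* * inner x y = t.
  rewrite /a rmorphM fmorphV/= (geC0_conj (ltW y2)).
  by rewrite mulrAC -normCKC.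
have t_real : t^* = t.
  by rewrite geC0_conj// mulr_ge0 ?invr_ge0 ?exprn_ge0.
have -> : `|a| ^+ 2 * `|y| ^+ 2 = t.
  by rewrite normCKC -mulrA /a divfK ?gt_eqF.
by rewrite at_ t_real opprD addrA addrK subr_ge0.
Qed.

Lemma bounded_op_comp f g : bounded_op f -> bounded_op g -> bounded_op (f \o g).
Proof.
move=> [lf cf] [lg cg]; split; first by move=> a x y /=; rewrite lg lf.
by move=> x; apply: continuous_comp; [exact: cg | exact: cf].
Qed.

Lemma bounded_op_lin (a : R[i]) f g :
  bounded_op f -> bounded_op g -> bounded_op (a *: f + g).
Proof.
move=> [lf cf] [lg cg]; split.
  move=> b x y; rewrite !fctE lf lg !scalerDr !scalerA mulrC -!addrA.
  by congr (_ + _); rewrite addrCA.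
move=> x; apply: cvgD; last exact: cg.
by apply: cvgZr; exact: cf.
Qed.

Lemma bounded_op0 : bounded_op (0 : H -> H).
Proof.
split; first by move=> a x y; rewrite -[LHS]/(0 : H) [RHS]addr0 scaler0.
by move=> x; exact: cvg_cst.
Qed.

Definition adjoint_pair f g :=
  [/\ bounded_op f, bounded_op g & forall x y, inner (f x) y = inner x (g y)].

Lemma adjoint_pairE f g : adjoint_pair f g -> adjoint f = g.
Proof.
move=> [_ bg fg]; rewrite /adjoint; apply: xget_unique => // h [_ fh].
by apply/funext => y; apply: inner_injr => x; rewrite -fg fh.
Qed.

Lemma adjoint_pairC f g : adjoint_pair f g -> adjoint_pair g f.
Proof.
by move=> [bf bg fg]; split=> // x y; rewrite innerC -fg -innerC.
Qed.

Lemma adjoint_pair_lin (a : R[i]) f f' g g' :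
  adjoint_pair f f' -> adjoint_pair g g' ->
  adjoint_pair (a *: f + g) (a^* *: f' + g').
Proof.
move=> [bf bf' ff'] [bg bg' gg']; split; try exact: bounded_op_lin.
by move=> x y; rewrite !fctE linearPl/= linearPr/= ff' gg' conjCK.
Qed.

Lemma adjoint_pair_comp f f' g g' :
  adjoint_pair f f' -> adjoint_pair g g' -> adjoint_pair (f \o g) (g' \o f').
Proof.
move=> [bf bf' ff'] [bg bg' gg']; split; try exact: bounded_op_comp.
by move=> x y /=; rewrite ff' gg'.
Qed.

Lemma adjoint_pair0 : adjoint_pair 0 0.
Proof.
by split; try exact: bounded_op0; move=> x y; rewrite linear0l linear0r.
Qed.

(** On these operators [adjoint] is a genuine adjoint and not the default value 0 of [xget]. They
    are stable under linear combinations, composition and adjoint, so the type [adj_op] below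
    carries a *-algebra to which the theory of matrix units applies. *)
Definition adjointable : {pred H -> H} :=
  fun f => `[< adjoint_pair f (adjoint f) >].

Lemma adjointableP f : reflect (adjoint_pair f (adjoint f)) (f \in adjointable).
Proof. exact: asboolP. Qed.

Lemma adjoint_pair_adjointable f g : adjoint_pair f g -> f \in adjointable.
Proof. by move=> fg; apply/adjointableP; rewrite (adjoint_pairE fg). Qed.

Let adjointable_submod_closed : submod_closed adjointable.
Proof.
split; first exact: adjoint_pair_adjointable adjoint_pair0.
move=> a f g /adjointableP af /adjointableP ag.
exact: adjoint_pair_adjointable (adjoint_pair_lin a af ag).
Qed.

HB.instance Definition _ :=
  GRing.isSubmodClosed.Build R[i] (H -> H) adjointable
    adjointable_submod_closed.

Record adj_op :=
  AdjOp { adj_val :> H -> H ; adj_valP : adj_val \in adjointable }.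

HB.instance Definition _ := [isSub of adj_op for adj_val].
HB.instance Definition _ := [Choice of adj_op by <:].
HB.instance Definition _ := [SubChoice_isSubLmodule of adj_op by <:].

Implicit Types u v : adj_op.

Lemma adj_op_pair u : adjoint_pair u (adjoint u).
Proof. exact/adjointableP/adj_valP. Qed.

Definition adj_mul u v : adj_op := AdjOp (adjoint_pair_adjointable
  (adjoint_pair_comp (adj_op_pair u) (adj_op_pair v))).

Definition adj_star u : adj_op := AdjOp (adjoint_pair_adjointable
  (adjoint_pairC (adj_op_pair u))).

Lemma adj_val_inj : injective adj_val.
Proof. exact: val_inj. Qed.

Lemma adj_val_lin (a : R[i]) u v :
  adj_val (a *: u + v) = a *: adj_val u + adj_val v.
Proof. exact: (linearP (val : adj_op -> H -> H)). Qed.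

Lemma adj_star_algebra : star_algebra adj_mul adj_star.
Proof.
split=> [u v w|v a u u'|u a v v'|a u v|u|u v]; apply: adj_val_inj.
- by [].
- by rewrite adj_val_lin; exact: (congr1 (comp^~ v) (adj_val_lin a u u')).
- have [[lu _] _ _] := adj_op_pair u.
  rewrite adj_val_lin; transitivity (u \o (a *: adj_val v + adj_val v')).
    exact: (congr1 (comp u) (adj_val_lin a v v')).
  by apply/funext => x; exact: lu.
- rewrite adj_val_lin; apply: adjoint_pairE; rewrite adj_val_lin.
  by apply: adjoint_pair_lin; exact: adj_op_pair.
- exact/adjoint_pairE/adjoint_pairC/adj_op_pair.
- by apply/adjoint_pairE/adjoint_pair_comp; exact: adj_op_pair.
Qed.

Lemma adj_val_ternary u v w :
  adj_val (star_ternary adj_mul adj_star u v w) = op_ternary u v w.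
Proof. by []. Qed.

(* If f had no adjoint, then [adjoint f] would be the default value 0, and
   f = f f^* f = 0 would have one: the Riesz theorem is not needed. *)
Lemma tripotent_adjointable f :
  bounded_op f -> jordan_triple op_ternary f f f = f -> f \in adjointable.
Proof.
move=> bf fff; have [|nadj] := pselect (exists g, adjoint_pair f g).
  by move=> [g fg]; exact: adjoint_pair_adjointable fg.
suff -> : f = 0 by exact: adjoint_pair_adjointable adjoint_pair0.
have a0 : adjoint f = 0.
  apply: xgetPN => g [bg fg]; apply: nadj; exists g; split=> //.
rewrite -fff /jordan_triple /op_ternary a0.
have f0 : f 0 = 0.
  by have := bf.1 (- 1) 0 0; rewrite !scaleN1r oppr0 addr0 addNr.
suff -> : f \o 0 \o f = 0 by rewrite addr0 scaler0.
by apply/funext => x /=.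
Qed.
End AdjointableOperators.
Arguments adj_op {R} H.

(** * The Hilbert space of row vectors *)

(* A fresh alias, since row vectors carry the topology of the sup norm. *)
Definition l2 (R : realType) (n : nat) : Type := 'rV[R[i]]_n.

Section L2.
Context {R : realType} {n : nat}.

HB.instance Definition _ := GRing.Lmodule.copy (l2 R n) 'rV[R[i]]_n.

Definition l2_norm (x : l2 R n) : R[i] := sqrtC (dotmx x x).

Let l2_normD x y : l2_norm (x + y) <= l2_norm x + l2_norm y.
Proof. exact: triangle_lerif. Qed.

Let l2_normZ (a : R[i]) x : l2_norm (a *: x) = `|a| * l2_norm x.
Proof.
rewrite /l2_norm [dotmx _ _](dnormZ (@dotmx R[i] n)).
rewrite sqrtCM ?nnegrE ?exprn_ge0//.
by rewrite sqrCK.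
Qed.

Let l2_norm_eq0 x : l2_norm x = 0 -> x = 0.
Proof. by move/eqP; rewrite sqrtC_eq0 (dnorm_eq0 (@dotmx R[i] n)) => /eqP. Qed.

HB.instance Definition _ :=
  Lmodule_isNormed.Build R[i] (l2 R n) l2_normD l2_normZ l2_norm_eq0.

Lemma l2_normE (x : l2 R n) : `|x| = sqrtC (dotmx x x). Proof. by []. Qed.

Lemma l2_dotE (x y : l2 R n) : dotmx x y = \sum_i x 0 i * (y 0 i)^*.
Proof. by rewrite dotmxE mxE; apply: eq_bigr => i _; rewrite !mxE. Qed.

Lemma l2_norm_ge_coord (x : l2 R n) i : `|x 0 i| <= `|x|.
Proof.
rewrite l2_normE -(sqrCK (normr_ge0 (x 0 i))) ler_sqrtC ?nnegrE ?exprn_ge0//.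
  rewrite l2_dotE (bigD1 i)//= -normCK lerDl sumr_ge0// => j _.
  by rewrite mul_conjC_ge0.
exact: (dnorm_ge0 (@dotmx R[i] n)).
Qed.

Lemma l2_norm_le_sum (x : l2 R n) : `|x| <= \sum_i `|x 0 i|.
Proof.
have e i : `|delta_mx 0 i : l2 R n| = 1.
  rewrite l2_normE l2_dotE (bigD1 i)//= big1 => [|j ji]; last first.
    by rewrite mxE (negbTE ji) andbF mul0r.
  by rewrite mxE !eqxx addr0 mul1r rmorph1 sqrtC1.
have -> : x = \sum_i (x 0 i *: (delta_mx 0 i : l2 R n)) by exact: row_sum_delta.
apply: le_trans (ler_norm_sum _ _ _) _; apply: ler_sum => i _.
rewrite normrZ e mulr1 -row_sum_delta //.
Qed.

(** The real and imaginary parts of each coordinate converge by completeness of the reals, and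
    finitely many coordinates control the norm. *)
Let l2_complete (F : set_system (l2 R n)) :
  ProperFilter F -> cauchy F -> cvg F.
Proof.
move=> FF /cauchy_ballP Fc.
(* To be used with the real part and the imaginary part, which are additive and contracting. *)
have coord_cvg (f : R[i] -> R) : (forall a b, f (a - b) = f a - f b) ->
    (forall a, real_complex R `|f a| <= `|a|) ->
    forall i, cvg ((fun x : l2 R n => f (x 0 i)) @ F).
  move=> fB fle i; apply: cauchy_cvg; apply/cauchy_ballP => e e0.
  rewrite near_map2.
  have e0' : 0 < real_complex R e by rewrite ltcR.
  have := Fc _ e0'; apply: filterS => -[x y] /=.
  rewrite -ball_normE /= /ball_ /ball/= => xy.
  rewrite -ltcR -fB; apply: le_lt_trans (fle _) _.
  apply: le_lt_trans xy; have := l2_norm_ge_coord (x - y) i.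
  by rewrite !mxE.
have cle (z : R[i]) :
    `|z| <= real_complex R (`|complex.Re z| + `|complex.Im z|).
  rewrite {1}(complexE z) rmorphD/=; apply: le_trans (ler_normD _ _) _.
  rewrite normrM complexiE normCi mul1r !normc_def /= expr0n addr0 addr0.
  by rewrite !sqrtr_sqr.
have Im_le (z : R[i]) : real_complex R `|complex.Im z| <= `|z|.
  by rewrite normc_def lecR -sqrtr_sqr ler_wsqrtr// lerDr sqr_ge0.
have Rec :=
  coord_cvg (@complex.Re R) (fun a b => raddfB _ a b) (@normc_ge_Re R).
have Imc := coord_cvg (@complex.Im R) (fun a b => raddfB _ a b) Im_le.
pose lRe i : R := lim ((fun x : l2 R n => complex.Re (x 0 i)) @ F).
pose lIm i : R := lim ((fun x : l2 R n => complex.Im (x 0 i)) @ F).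
apply/cvg_ex; exists (\row_i (lRe i +i* lIm i)%C : l2 R n).
apply/cvgrPdist_lt => e e0.
have [r er] : exists r : R, e = real_complex R r.
  by exists (complex.Re e); rewrite RRe_real// gtr0_real.
have r0 : 0 < r by rewrite -ltcR -er.
(* Each of the n coordinates contributes at most 2 d, in total n r / (n + 1) < r; n + 1 also covers
   n = 0. *)
pose d : R := r / (2 * n.+1%:R).
have d0 : 0 < d by rewrite divr_gt0// mulr_gt0// ltr0n.
near=> x.
have xRe i : `|lRe i - complex.Re (x 0 i)| < d.
  move: i; near: x; apply: filter_forall => i.
  by move/cvgrPdist_lt : (Rec i); apply.
have xIm i : `|lIm i - complex.Im (x 0 i)| < d.
  move: i; near: x; apply: filter_forall => i.
  by move/cvgrPdist_lt : (Imc i); apply.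
apply: le_lt_trans (l2_norm_le_sum _) _.
apply: (@le_lt_trans _ _ (\sum_(i < n) real_complex R (d + d))).
  apply: ler_sum => i _; apply: le_trans (cle _) _.
  have := lerD (ltW (xRe i)) (ltW (xIm i)).
  by rewrite lecR !mxE /=; case: (x 0 i).
rewrite sumr_const card_ord -raddfMn er ltcR -mulr_natr.
have -> : d + d = r / n.+1%:R.
  by rewrite /d; field; rewrite nat1r pnatr_eq0.
rewrite -mulrA gtr_pMr// mulrC ltr_pdivrMr ?ltr0n// mul1r ltr_nat//.
Unshelve. all: by end_near.
Qed.

HB.instance Definition _ :=
  Uniform_isComplete.Build (l2 R n) l2_complete.

Definition l2_inner (x y : l2 R n) : R[i] := dotmx x y.

HB.instance Definition _ := Dot.copy l2_inner (@dotmx R[i] n).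

Let l2_norm_inner (x : l2 R n) : `|x| ^+ 2 = l2_inner x x.
Proof. by rewrite l2_normE sqrtCK. Qed.

HB.instance Definition _ :=
  @CompleteNormedModule_isHilbert.Build R (l2 R n) l2_inner l2_norm_inner.

Lemma l2_innerE (x y : l2 R n) : inner x y = \sum_i x 0 i * (y 0 i)^*.
Proof. exact: l2_dotE. Qed.
End L2.

Lemma linear_lincomb (K : pzRingType) (V W : lmodType K) (f : V -> W)
    (I : finType) (c : I -> K) (v : I -> V) :
  linear f -> f (\sum_i c i *: v i) = \sum_i c i *: f (v i).
Proof.
move=> lf; pose lfM := GRing.isLinear.Build K V W _ f lf.
pose F : {linear V -> W} := HB.pack f lfM.
rewrite -[f]/(F : V -> W) linear_sum; apply: eq_bigr => i _.
by rewrite linearZ_LR.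
Qed.

(** * Operators on the row space as matrices *)

Section L2Operators.
Context {R : realType} {n : nat}.
Implicit Types M N P : 'M[R[i]]_n.

(* Vectors are rows, so M acts through its transpose. *)
Definition l2_op M : l2 R n -> l2 R n := fun x => (x : 'rV_n) *m M^T.

Lemma l2_op_coord M (x : l2 R n) i : l2_op M x 0 i = \sum_j x 0 j * M i j.
Proof. by rewrite mxE; apply: eq_bigr => j _; rewrite mxE. Qed.

Lemma linear_l2_bounded (H : hilbertType R) (f : l2 R n -> H) : linear f ->
  exists2 K : R[i], 0 <= K & forall x, `|f x| <= K * `|x|.
Proof.
move=> lf; pose c i := `|f (delta_mx 0 i)|.
exists (\sum_i c i) => [|x]; first by apply: sumr_ge0 => i _; exact: normr_ge0.
have -> : f x = \sum_i (x 0 i *: f (delta_mx 0 i)).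
  have {1}-> : x = \sum_i (x 0 i *: (delta_mx 0 i : l2 R n)).
    exact: row_sum_delta.
  exact: linear_lincomb.
apply: le_trans (ler_norm_sum _ _ _) _; rewrite mulr_suml.
apply: ler_sum => i _; rewrite normrZ mulrC ler_wpM2l//.
exact: l2_norm_ge_coord.
Qed.

Lemma linear_l2_continuous (H : hilbertType R) (f : l2 R n -> H) :
  linear f -> continuous f.
Proof.
move=> lf x; have [K K0 fK] := linear_l2_bounded lf.
apply/(@cvgrPdist_lt _ _ _ (nbhs x)) => e e0.
(* K may be 0, hence the divisor K + 1. *)
have d0 : 0 < e / (K + 1) by rewrite divr_gt0// ltr_wpDl.
near=> y.
have -> : f x - f y = f (x - y).
  have := lf (- 1) y x; rewrite !scaleN1r => fxy.
  by rewrite addrC -fxy [x - y]addrC.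
apply: le_lt_trans (fK _) _.
apply: (@le_lt_trans _ _ ((K + 1) * `|x - y|)).
  by rewrite ler_wpM2r// lerDl.
rewrite mulrC -ltr_pdivlMr ?ltr_wpDl//.
Unshelve. all: by end_near. Qed.

Lemma l2_op_bounded M : bounded_op (l2_op M).
Proof.
have lM : linear (l2_op M).
  by move=> a x y; rewrite /l2_op mulmxDl scalemxAl.
by split=> //; exact: linear_l2_continuous.
Qed.

Lemma l2_op_adjoint M : adjoint_pair (l2_op M) (l2_op (mx_ctranspose M)).
Proof.
split; try exact: l2_op_bounded.
move=> x y; rewrite !l2_innerE.
under eq_bigr do rewrite l2_op_coord mulr_suml.
rewrite exchange_big; apply: eq_bigr => j _ /=.
rewrite l2_op_coord rmorph_sum mulr_sumr; apply: eq_bigr => i _.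
by rewrite !mxE rmorphM/= conjCK -mulrA; congr (_ * _); rewrite mulrC.
Qed.

Lemma l2_op_linear : linear l2_op.
Proof.
move=> a M N; apply/funext => x.
rewrite /l2_op linearD linearZ/= mulmxDr -scalemxAr.
by [].
Qed.

Lemma l2_opD M N : l2_op (M + N) = l2_op M + l2_op N.
Proof. by have := l2_op_linear 1 M N; rewrite !scale1r. Qed.

Lemma l2_op0 : l2_op 0 = 0.
Proof. by apply: (addIr (l2_op 0)); rewrite -l2_opD !add0r. Qed.

Lemma l2_opZ a M : l2_op (a *: M) = a *: l2_op M.
Proof. by have := l2_op_linear a M 0; rewrite l2_op0 !addr0. Qed.

Lemma l2_op_ternary M N P :
  l2_op (mx_ternary M N P) = op_ternary (l2_op M) (l2_op N) (l2_op P).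
Proof.
rewrite /op_ternary (adjoint_pairE (l2_op_adjoint N)).
by apply/funext => x; rewrite /= /l2_op /mx_ternary !trmx_mul !mulmxA.
Qed.

Definition l2_mx (f : l2 R n -> l2 R n) : 'M[R[i]]_n :=
  \matrix_(i, j) f (delta_mx 0 j) 0 i.

Lemma l2_opK : cancel l2_op l2_mx.
Proof.
move=> M; apply/matrixP => i j; rewrite mxE l2_op_coord (bigD1 j)//=.
rewrite big1 => [|k kj]; last by rewrite mxE (negbTE kj) andbF mul0r.
by rewrite mxE !eqxx mul1r addr0.
Qed.

Lemma l2_mxK f : bounded_op f -> l2_op (l2_mx f) = f.
Proof.
move=> [lf _]; apply/funext => x; apply/rowP => i; rewrite l2_op_coord.
have {2}-> : x = \sum_i (x 0 i *: (delta_mx 0 i : l2 R n)).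
  exact: row_sum_delta.
rewrite linear_lincomb// summxE; apply: eq_bigr => j _.
by rewrite !mxE.
Qed.

(** Every bounded operator on this space comes from a matrix, so stability under the ternary product
    reduces to the matrix product, where adjoints are explicit. *)
Lemma l2_bounded_op_TRO : is_TRO (@bounded_op R (l2 R n)).
Proof.
split=> //.
- by split=> [|a f g]; [exact: bounded_op0 | exact: bounded_op_lin].
- move=> f g h /l2_mxK <- /l2_mxK <- /l2_mxK <-.
  by rewrite -l2_op_ternary; exact: l2_op_bounded.
Qed.
End L2Operators.

(** * The span of matrix units *)

Section UnitSpan.
Context {R : realType} {H : hilbertType R} {n : nat}.
Context {e : 'I_n -> 'I_n -> adj_op H}.
Hypothesis mu : matrix_units (mul := adj_mul) (star := adj_star) e.
Hypothesis e_neq0 : forall i, e i i != 0.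

Let T := range (fun M => adj_val (mx_elt e M)).

Lemma adj_valD (u v : adj_op H) y : (u + v) y = u y + v y.
Proof. by have := congr1 (@^~ y) (adj_val_lin 1 u v); rewrite /= !scale1r. Qed.

Lemma adj_val0 y : (0 : adj_op H) y = 0.
Proof. by apply: (addIr ((0 : adj_op H) y)); rewrite -adj_valD !add0r. Qed.

Lemma adj_valZ a (u : adj_op H) y : (a *: u) y = a *: u y.
Proof.
have := congr1 (@^~ y) (adj_val_lin a u 0); rewrite addr0 => ->.
by rewrite -[RHS]addr0 -[X in _ = _ + X](adj_val0 y).
Qed.

Lemma adj_val_mx_elt M (y : H) :
  mx_elt e M y = \sum_i \sum_j M i j *: e i j y.
Proof.
pose ev (u : adj_op H) := u y.
have evD : {morph ev : u v / u + v} by move=> u v; exact: adj_valD.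
have ev0 : ev 0 = 0 by exact: adj_val0.
rewrite -/(ev _) /mx_elt (big_morph ev evD ev0).
apply: eq_bigr => i _; rewrite (big_morph ev evD ev0).
by apply: eq_bigr => j _; exact: adj_valZ.
Qed.

(** The functional given by xi and eta makes sense on all operators and is controlled by the
    operator norm. It therefore assigns coefficients to a norm limit of elements of the span. *)
Lemma mx_elt_coord i j : exists xi eta : H,
  eta != 0 /\ forall M, inner (mx_elt e M xi) eta = M i j * `|eta| ^+ 2.
Proof.
have [x ex] : exists x, e i i x != 0.
  apply: contrapT => /forallNP ex0; move: (e_neq0 i); apply/negP/negPn/eqP.
  apply: adj_val_inj; apply/funext => x.
  by apply/eqP/negPn/negP; exact: ex0.
(* Since eta = e_ii x = e_ii e_ii^* eta, the factor e_ii e_ii^* can be moved to the left side of the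
   inner product, where [mx_elt_compress] applies. *)
exists (adj_star (e i j) (e i i x)), (e i i x); split=> // M.
have cubed : e i i x = e i i (adj_star (e i i) (e i i x)).
  have := mu i i i i i i; rewrite eqxx/= => /(congr1 (fun u : adj_op H => u x)).
  by move=> h; exact: esym h.
have [_ _ adj] := adj_op_pair (e i i).
have [_ _ adj'] := adjoint_pairC (adj_op_pair (e i i)).
rewrite [X in inner _ X]cubed -adj' -adj norm_inner.
transitivity (inner ((M i j *: e i i) x) (e i i x)).
  by rewrite -(mx_elt_compress adj_star_algebra mu).
by rewrite adj_valZ linearZl_LR.
Qed.

Lemma le_small_eq0 (a K : R[i]) :
  0 <= a -> 0 <= K -> (forall eps, 0 < eps -> a <= eps * K) -> a = 0.
Proof.
move=> a0 K0 aK; apply: contrapT => /eqP an0.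
have {an0}a0 : 0 < a by rewrite lt_def an0.
have K1 : 0 < K + 1 by rewrite ltr_wpDl.
have := aK (a / (K + 1)) (divr_gt0 a0 K1).
rewrite mulrAC ler_pdivlMr// ler_pM2l// => KK.
by move: KK; rewrite gerDl ler10.
Qed.

Lemma range_mx_elt_TRO : is_TRO T.
Proof.
split.
- by move=> _ [M _ <-]; case: (adj_op_pair (mx_elt e M)).
- split; first by exists 0 => //; rewrite mx_elt0.
  move=> a _ _ [M _ <-] [N _ <-]; exists (a *: M + N) => //.
  by rewrite mx_elt_linear adj_val_lin.
- move=> f [lf cf] approx.
  have /choice[xi /choice[eta xieta]] : forall ij : 'I_n * 'I_n,
      exists xi eta : H, eta != 0 /\
      forall M, inner (mx_elt e M xi) eta = M ij.1 ij.2 * `|eta| ^+ 2.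
    by move=> ij; exact: mx_elt_coord.
  (* These are the only possible coefficients for the limit f. It remains to bound f y -
     [mx_elt e c y] by eps times a constant independent of eps. *)
  pose c := \matrix_(i, j) (inner (f (xi (i, j))) (eta (i, j)) /
    `|eta (i, j)| ^+ 2).
  exists c => //; apply/funext => y.
  apply/eqP; rewrite eq_sym -subr_eq0 -normr_eq0; apply/eqP.
  (* By Cauchy-Schwarz, a bound for the norm of the functional computing the (i, j) coefficient. *)
  pose C i j := `|xi (i, j)| * `|eta (i, j)| / `|eta (i, j)| ^+ 2.
  have C0 i j : 0 <= C i j by rewrite !mulr_ge0// invr_ge0 exprn_ge0.
  apply: (@le_small_eq0 _ (`|y| + \sum_i \sum_j C i j * `|e i j y|)) => //.
    rewrite addr_ge0// sumr_ge0// => i _; rewrite sumr_ge0// => j _.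
    by rewrite mulr_ge0.
  move=> eps eps0; have [_ [M _ <-] fM] := approx eps eps0.
  have cM i j : `|M i j - c i j| <= eps * C i j.
    have [eta0 /(_ M) /= MM] := xieta (i, j).
    have e2 : 0 < `|eta (i, j)| ^+ 2 by rewrite exprn_gt0// normr_gt0.
    have -> : M i j = inner (mx_elt e M (xi (i, j))) (eta (i, j)) /
        `|eta (i, j)| ^+ 2 by rewrite MM mulfK// gt_eqF.
    rewrite mxE -mulrBl -linearBl normrM normfV.
    rewrite [X in _ / X](ger0_norm (ltW e2)).
    rewrite /C !mulrA ler_pM2r ?invr_gt0//.
    apply: le_trans (inner_le _ _) _; rewrite ler_wpM2r//.
    by rewrite distrC; exact: fM.
  (* Passing through the approximant M: its distance to f at y is at most eps |y|, and its
     coefficients differ from c by at most eps C_ij. *)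
  rewrite -(subrKA (mx_elt e M y)); apply: le_trans (ler_normD _ _) _.
  rewrite mulrDr lerD//.
  rewrite !adj_val_mx_elt -sumrB mulr_sumr.
  apply: le_trans (ler_norm_sum _ _ _) _; apply: ler_sum => i _.
  rewrite -sumrB mulr_sumr.
  apply: le_trans (ler_norm_sum _ _ _) _; apply: ler_sum => j _.
  by rewrite -scalerBl normrZ mulrA ler_wpM2r.
- move=> _ _ _ [M _ <-] [N _ <-] [P _ <-].
  exists (mx_ternary M N P) => //.
  by rewrite -adj_val_ternary (mx_elt_ternary adj_star_algebra mu).
Qed.

Lemma mx_elt_iso : TRO_iso_matrices T n.
Proof.
have inj : injective (fun M => adj_val (mx_elt e M)).
  move=> M N /adj_val_inj; exact: (mx_elt_inj adj_star_algebra mu).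
have [g gK] : exists g, cancel (fun M => adj_val (mx_elt e M)) g.
  exists (fun f => xget 0 [set M | adj_val (mx_elt e M) = f]) => M.
  by apply: xget_unique => // N /inj.
exists g; split.
  split=> //.
  - move=> a _ _ [M _ <-] [N _ <-].
    by rewrite -adj_val_lin -mx_elt_linear !gK.
  - move=> _ _ _ [M _ <-] [N _ <-] [P _ <-].
    rewrite -adj_val_ternary (mx_elt_ternary adj_star_algebra mu).
    by rewrite -/(mx_ternary M N P) !gK.
split=> //.
- by move=> _ _ /set_mem[M _ <-] /set_mem[N _ <-]; rewrite !gK => ->.
- by move=> M _; exists (adj_val (mx_elt e M)); rewrite ?gK//; exists M.
Qed.
End UnitSpan.

(** * Hermitian grids *)

Lemma cstar_star_algebra (R : realType) (A : cstarAlgType R) :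
  star_algebra (@cmul R A) (@star R A).
Proof.
split; [exact: cmulA | exact: cmul_linearl | exact: cmul_linearr |
  exact: star_antilinear | exact: starK | exact: starM].
Qed.

Lemma linear_on0 (K : fieldType) (V W : lmodType K) (S : set V) (f : V -> W) :
  S 0 ->
  (forall (a : K) x y, S x -> S y -> f (a *: x + y) = a *: f x + f y) ->
  f 0 = 0.
Proof.
move=> S0 fl; have := fl (- 1) 0 0 S0 S0.
by rewrite !scaleN1r oppr0 addr0 => ->; rewrite addNr.
Qed.

Lemma subspace_lincomb (K : fieldType) (V W : lmodType K) (S : set V)
    (f : V -> W) (I : finType) (c : I -> K) (v : I -> V) :
  is_subspace S ->
  (forall (a : K) x y, S x -> S y -> f (a *: x + y) = a *: f x + f y) ->
  (forall i, S (v i)) ->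
  S (\sum_i c i *: v i) /\ f (\sum_i c i *: v i) = \sum_i c i *: f (v i).
Proof.
move=> [S0 SD] fl Sv.
have f0 := linear_on0 S0 fl.
elim/big_rec2: _ => // i y x _ [Sx <-].
by split; [exact: SD | exact: fl].
Qed.

Section Grid.
Context {K : fieldType} {V : lmodType K} {t : V -> V -> V -> V}.
Context {I : eqType} {u : I -> I -> V} {Z : set V}.
Hypothesis gu : hermitian_grid t u Z.

(* The triple {u i i, u i i, u j k} vanishes exactly when i is not in {j, k}. *)
Lemma grid_index_mem i j k l : 2%:R != 0 :> K ->
  u i j = u k l -> (i == k) || (i == l).
Proof.
move=> two ijkl; apply/negPn/negP; rewrite negb_or => /andP[/eqP ik /eqP il].
have ki := nesym ik; have li := nesym il.
have := grid_HG2 gu ki ki li li; rewrite -ijkl => u0.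
have [ij|/eqP ij] := eqVneq i j.
  by move: u0; rewrite -ij (grid_tripotent gu); exact: (grid_neq0 gu).
have [+ _] := grid_HG3 gu ij; rewrite u0 => /esym/eqP.
rewrite scaler_eq0 invr_eq0 (negbTE two)/=; apply/negP/eqP.
exact: (grid_neq0 gu).
Qed.

(** (HG5) asks for distinct grid elements, while [grid_chain] excludes a pattern of indices. If the
    three elements agree, [grid_index_mem] puts k and l in {i, j} and i in {k, l}; as i and l
    differ, only k = i, l = j survives. *)
Lemma grid_chain_neq i j k l : 2%:R != 0 :> K -> i <> l ->
  ~ (k = i /\ l = j) -> ~ (u i j = u j k /\ u j k = u k l).
Proof.
move=> two il nkl [e1 e2]; apply: nkl.
have /(grid_index_mem two)/orP[/eqP li|/eqP lj] : u l k = u i j.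
- by rewrite e1 e2 (grid_HG1 gu).
- by case: il.
have /(grid_index_mem two)/orP[/eqP ki|/eqP kj] : u k j = u i j.
- by rewrite e1 (grid_HG1 gu).
- by split.
have := grid_index_mem two (etrans e1 e2); rewrite kj lj orbb => /eqP ij.
by case: il; rewrite ij lj.
Qed.

End Grid.

Section JordanGrid.
Context {C : numClosedFieldType} {A V : lmodType C}.
Context {t : A -> A -> A -> A} {Z : set A} {I : eqType} {u : I -> I -> A}.
Context {mul : V -> V -> V} {star : V -> V}.
Hypothesis gu : hermitian_grid t u Z.

(** Stated for a Jordan homomorphism f in order to cover both the grid inside A, with f the
    identity, and its image among the operators of a TRO. *)
Lemma hermitian_grid_relations (f : A -> V) :
  is_subspace Z ->
  (forall (a : C) x y, Z x -> Z y -> f (a *: x + y) = a *: f x + f y) ->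
  (forall x y z, Z x -> Z y -> Z z -> f (t x y z) =
     jordan_triple (star_ternary mul star) (f x) (f y) (f z)) ->
  grid_relations (mul := mul) (star := star) (fun i j => f (u i j)).
Proof.
move=> [Z0 ZD] fl ft.
have two : 2%:R != 0 :> C by rewrite pnatr_eq0.
have f0 := linear_on0 Z0 fl.
have fZ a x : Z x -> f (a *: x) = a *: f x.
  by move=> Zx; have := fl a x 0 Zx Z0; rewrite f0 !addr0.
have Zu := grid_mem gu.
have jordan i j k l p q b v : Z v -> t (u i j) (u k l) (u p q) = b *: v ->
    star_ternary mul star (f (u i j)) (f (u k l)) (f (u p q)) +
    star_ternary mul star (f (u p q)) (f (u k l)) (f (u i j)) =
    (2 * b) *: f v.
  move=> Zv h; rewrite -scalerA -fZ// -h ft// /jordan_triple.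
  by rewrite scalerA divff// scale1r.
have jordan_half i j k l p q v : Z v ->
    t (u i j) (u k l) (u p q) = 2^-1 *: v ->
    star_ternary mul star (f (u i j)) (f (u k l)) (f (u p q)) +
    star_ternary mul star (f (u p q)) (f (u k l)) (f (u i j)) = f v.
  by move=> Zv /(jordan _ _ _ _ _ _ _ _ Zv) ->; rewrite divff// scale1r.
(* With equal outer entries the two halves of the Jordan product coincide, so each of them is
   determined. *)
have jordan_sym i j k l v : Z v -> t (u i j) (u k l) (u i j) = v ->
    star_ternary mul star (f (u i j)) (f (u k l)) (f (u i j)) = f v.
  move=> Zv h; have := jordan i j k l i j 1 v Zv.
  rewrite h scale1r mulr1 => /(_ erefl) /eqP.
  by rewrite -mulr2n -scaler_nat (can_eq (scalerK two)) => /eqP.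
split.
- by move=> i j; rewrite (grid_HG1 gu).
- by move=> i j; apply: jordan_sym => //; exact: (grid_tripotent gu).
- move=> i j /eqP ij; have ji := nesym ij.
  have := jordan i i i i j j 0 0 Z0; rewrite mulr0 !scale0r; apply.
  by exact: (grid_HG2 gu).
- move=> i j /eqP ij; apply: jordan_half => //.
  by have [] := grid_HG3 gu ij.
- move=> i j k l /eqP il nkl; apply: jordan_half => //.
  apply: (grid_HG5 gu) => //; apply: (grid_chain_neq gu) => //.
  by move=> [ki lj]; move: nkl; rewrite ki lj !eqxx.
- move=> i j /eqP ij; rewrite (grid_HG1 gu j i); apply: jordan_sym => //.
  rewrite {2}(grid_HG1 gu i j); apply: (grid_HG6 gu) => -[e1 _].
  have := grid_index_mem gu two e1; rewrite orbb => /eqP.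
  exact: ij.
Qed.
End JordanGrid.

(** The symmetric matrix representing u_ij. The diagonal is a separate case because the sum would
    give twice the unit. *)
Definition grid_mx (K : pzRingType) n (i j : 'I_n) : 'M[K]_n :=
  if i == j then delta_mx i i else delta_mx i j + delta_mx j i.

Lemma mx_elt_grid (C : numClosedFieldType) (V : lmodType C) mul star n
    (w : 'I_n -> 'I_n -> V) (i j : 'I_n) :
  star_algebra mul star -> grid_relations (mul := mul) (star := star) w ->
  mx_elt (grid_unit (mul := mul) (star := star) (w := w)) (grid_mx C i j) =
  w i j.
Proof.
move=> sa gw; rewrite /grid_mx; have [<-|ij] := eqVneq i j.
  by rewrite mx_elt_delta (grid_unit_diag gw).
by rewrite mx_eltD !mx_elt_delta (grid_unitD sa gw ij).
Qed.

Lemma mx_elt_subspace (C : numClosedFieldType) (V : lmodType C) n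
    (e : 'I_n -> 'I_n -> V) (S : set V) M :
  is_subspace S -> (forall i j, S (e i j)) -> S (mx_elt e M).
Proof.
move=> [S0 SD] Se; have SA x y : S x -> S y -> S (x + y).
  by move=> Sx Sy; rewrite -[x]scale1r; exact: SD.
apply: big_ind => // i _; apply: big_ind => // j _.
by rewrite -[_ *: _]addr0; exact: SD.
Qed.

(** * The universal TRO of the span of a hermitian grid *)

Section UniversalTRO.
Context {R : realType} {A : cstarAlgType R} {Z : set A} {n : nat}.
Context {u : 'I_n -> 'I_n -> A}.
Hypothesis Z_JCstar : is_JCstar_triple Z.
Hypothesis gu : hermitian_grid (jordan_triple cstar_ternary) u Z.
Hypothesis u_span : Z = lin_span (fun ij : 'I_n * 'I_n => u ij.1 ij.2).

Let e := grid_unit (mul := cmul) (star := star) (w := u).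
Let saA := cstar_star_algebra A.

Let gwA : grid_relations (mul := cmul) (star := star) u.
Proof.
by case: Z_JCstar => sZ _ _; exact: (hermitian_grid_relations gu (f := idfun)).
Qed.

Let mu_e : matrix_units (mul := cmul) (star := star) e.
Proof. exact: grid_unitsP. Qed.

Let e_inj : injective (mx_elt e).
Proof.
apply: (mx_elt_inj saA mu_e) => i; rewrite /e (grid_unit_diag gwA).
by apply/eqP; exact: (grid_neq0 gu).
Qed.

(** Coordinates with respect to units of A; the off-diagonal units lie outside Z, whose elements get
    symmetric matrices. Off the span of the units the value is the default 0. *)
Definition grid_coord (x : A) : 'M[R[i]]_n := xget 0 [set M | mx_elt e M = x].

Lemma mx_eltK : cancel (mx_elt e) grid_coord.
Proof. by move=> M; apply: xget_unique => // N /e_inj. Qed.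

Lemma mx_elt_coefs (c : 'I_n * 'I_n -> R[i]) :
  mx_elt e (\sum_ij c ij *: grid_mx _ ij.1 ij.2) = \sum_ij c ij *: u ij.1 ij.2.
Proof.
rewrite mx_elt_sum; apply: eq_bigr => ij _.
by rewrite mx_eltZ (mx_elt_grid _ _ saA gwA).
Qed.

Lemma grid_coordK x : Z x -> mx_elt e (grid_coord x) = x.
Proof. by rewrite u_span => -[c ->]; rewrite -mx_elt_coefs mx_eltK. Qed.

Lemma grid_coord_u i j : grid_coord (u i j) = grid_mx _ i j.
Proof. by rewrite -(mx_elt_grid i j saA gwA) mx_eltK. Qed.

Lemma grid_coord_linear (a : R[i]) x y : Z x -> Z y ->
  grid_coord (a *: x + y) = a *: grid_coord x + grid_coord y.
Proof.
move=> /grid_coordK {1}<- /grid_coordK {1}<-.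
by rewrite -mx_elt_linear mx_eltK.
Qed.

Lemma grid_coord_triple x y z : Z x -> Z y -> Z z ->
  grid_coord (jordan_triple cstar_ternary x y z) =
  jordan_triple (@mx_ternary R n) (grid_coord x) (grid_coord y) (grid_coord z).
Proof.
have tern a b c : cstar_ternary (mx_elt e a) (mx_elt e b) (mx_elt e c) =
    mx_elt e (mx_ternary a b c) := mx_elt_ternary saA mu_e a b c.
move=> /grid_coordK {1}<- /grid_coordK {1}<- /grid_coordK {1}<-.
by rewrite /jordan_triple !tern -mx_eltD -mx_eltZ mx_eltK.
Qed.

(** The images of the grid are tripotents, hence adjointable, so alpha maps Z into the *-algebra
    [adj_op]. The grid relations hold there and produce units e', each a ternary product of values
    of alpha and so an element of T. Both sides of the last claim agree on the grid, which spans
    Z. *)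
Lemma JBstar_hom_factor (H : hilbertType R) (T : set (H -> H)) alpha :
  is_TRO T -> JBstar_hom Z T alpha ->
  exists e' : 'I_n -> 'I_n -> adj_op H,
    [/\ matrix_units (mul := adj_mul) (star := adj_star) e',
        forall M, T (mx_elt e' M) &
        forall x, Z x -> alpha x = mx_elt e' (grid_coord x)].
Proof.
move=> [Tb sT _ Tt] [aT alin atriple]; have [sZ _ _] := Z_JCstar.
have Zu (ij : 'I_n * 'I_n) : Z (u ij.1 ij.2) by exact: (grid_mem gu).
have adj_u i j : alpha (u i j) \in adjointable.
  have Zij := grid_mem gu i j.
  apply: tripotent_adjointable; first exact/Tb/aT.
  by rewrite -atriple// (grid_tripotent gu).
have adj_Z x : Z x -> alpha x \in adjointable.
  rewrite u_span => -[c ->]; have [_ ->] := subspace_lincomb c sZ alin Zu.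
  by apply: rpred_sum => ij _; exact: rpredZ.
(* The default 0 is taken only where alpha x is not adjointable, which does not happen on Z. *)
pose f x : adj_op H := insubd 0 (alpha x).
have fE x : Z x -> adj_val (f x) = alpha x.
  by move=> Zx; exact: insubdK (adj_Z x Zx).
have flin (a : R[i]) x y : Z x -> Z y -> f (a *: x + y) = a *: f x + f y.
  move=> Zx Zy; apply: adj_val_inj; rewrite adj_val_lin !fE ?alin//.
  exact: sZ.2.
have saH := @adj_star_algebra R H.
have gw : grid_relations (mul := adj_mul) (star := adj_star)
    (fun i j => f (u i j)).
  apply: (hermitian_grid_relations gu) => // x y z Zx Zy Zz.
  apply: adj_val_inj; rewrite fE; last by case: Z_JCstar => _ _; exact.
  by rewrite atriple// -!fE.
pose e' := grid_unit (mul := adj_mul) (star := adj_star)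
  (w := fun i j => f (u i j)).
exists e'; split.
- exact: (grid_unitsP saH gw).
- move=> M; apply: (mx_elt_subspace (S := [set v | T (adj_val v)])).
    split; first exact: sT.1.
    by move=> a v v' Tv Tv'; have := sT.2 a _ _ Tv Tv'; rewrite -adj_val_lin.
  move=> i j.
  rewrite /= /e' grid_unitE.
  by apply: Tt; rewrite /= fE; try apply: aT; exact: (grid_mem gu).
- move=> x Zx; rewrite -fE//; congr adj_val.
  move: Zx; rewrite u_span => -[c ->].
  have [_ ->] := subspace_lincomb c sZ flin Zu.
  rewrite -mx_elt_coefs mx_eltK mx_elt_sum; apply: eq_bigr => ij _.
  by rewrite mx_eltZ (mx_elt_grid _ _ saH gw).
Qed.


Definition grid_rep (x : A) : l2 R n -> l2 R n := l2_op (grid_coord x).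

Lemma grid_rep_hom (T : set (l2 R n -> l2 R n)) :
  (forall M, T (l2_op M)) -> JBstar_hom Z T grid_rep.
Proof.
move=> TM; split=> [x _|a x y Zx Zy|x y z Zx Zy Zz]; first exact: TM.
  by rewrite /grid_rep grid_coord_linear// l2_op_linear.
rewrite /grid_rep grid_coord_triple// /jordan_triple -!l2_op_ternary.
by rewrite l2_opZ l2_opD.
Qed.

(** A TRO containing the symmetric matrices contains E_ij = E_ii E_ii^* (E_ij + E_ji) for i != j,
    hence every matrix. *)
Lemma grid_rep_generates :
  TRO_generated (grid_rep @` Z) = @bounded_op R (l2 R n).
Proof.
apply/seteqP; split.
  apply: smallest_sub; first exact: l2_bounded_op_TRO.
  by move=> _ [x _ <-]; exact: l2_op_bounded.
move=> f /l2_mxK <- T [[_ [T0 TD] _ Tt] ZT]; set M := l2_mx f.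
have TZ i j : T (l2_op (grid_mx _ i j)).
  rewrite -grid_coord_u; apply: ZT; exists (u i j) => //.
  exact: (grid_mem gu).
rewrite (matrix_sum_delta M).
apply: (mx_elt_subspace (S := [set N | T (l2_op N)])).
  split=> [|a N P TN TP] /=; last by rewrite l2_op_linear; exact: TD.
  by rewrite l2_op0.
move=> i j /=.
have Tii : T (l2_op (delta_mx i i)) by have := TZ i i; rewrite /grid_mx eqxx.
have [<- //|ij] := eqVneq i j.
have <- : mx_ternary (delta_mx i i) (delta_mx i i) (grid_mx R[i] i j) =
    delta_mx i j.
  rewrite /mx_ternary -/(mx_ctranspose _) mx_ctranspose_delta mul_delta_mx.
  rewrite /grid_mx (negbTE ij) mulmxDr mul_delta_mx mul_delta_mx_0 ?addr0//.
by rewrite l2_op_ternary; apply: Tt.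
Qed.

Lemma grid_rep_universal : is_universal_TRO Z (@bounded_op R (l2 R n)) grid_rep.
Proof.
split.
- exact: l2_bounded_op_TRO.
- by apply: grid_rep_hom => M; exact: l2_op_bounded.
- exact: grid_rep_generates.
move=> H T alpha TT halpha.
have [e' [mu' Te' alphaE]] := JBstar_hom_factor TT halpha.
(* The extension of alpha sends the matrix unit E_ij to e'_ij. *)
exists (fun f => adj_val (mx_elt e' (l2_mx f))).
  split=> [f _|a f g|f g h]; first exact: Te'.
    move=> /l2_mxK {1}<- /l2_mxK {1}<-.
    by rewrite -l2_op_linear l2_opK mx_elt_linear adj_val_lin.
  move=> /l2_mxK {1}<- /l2_mxK {1}<- /l2_mxK {1}<-.
  rewrite -l2_op_ternary l2_opK -adj_val_ternary.
  by rewrite (mx_elt_ternary adj_star_algebra mu').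
by move=> x Zx; rewrite alphaE// /grid_rep l2_opK.
Qed.

Lemma universal_TRO_iso (H : hilbertType R) (T : set (H -> H)) rho :
  is_universal_TRO Z T rho -> TRO_iso_matrices T n.
Proof.
move=> [TT hrho Tgen Tuniv].
have [e' [mu' Te' rhoE]] := JBstar_hom_factor TT hrho.
have [_ hrep _ _] := grid_rep_universal.
have [F [_ Flin _] FE] := Tuniv _ _ _ l2_bounded_op_TRO hrep.
(* If e'_ii were 0, then rho (u_ii) = 0, and applying F would give E_ii = 0 on the row space. *)
have e'_neq0 i : e' i i != 0.
  apply/eqP => e'0; have Zii := grid_mem gu i i; have [_ [T0 _] _ _] := TT.
  have F0 := linear_on0 T0 Flin.
  have := FE _ Zii; rewrite rhoE// /grid_rep grid_coord_u /grid_mx eqxx.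
  rewrite mx_elt_delta e'0.
  have -> : adj_val (0 : adj_op H) = 0 by apply/funext => v; exact: adj_val0.
  rewrite F0 => /(congr1 l2_mx); rewrite l2_opK => /matrixP/(_ i i).
  by rewrite !mxE !eqxx => /eqP; rewrite oner_eq0.
(* T lies in the range because the range is a TRO containing rho(Z), which generates T. *)
suff -> : T = range (fun M => adj_val (mx_elt e' M)) by exact: mx_elt_iso.
apply/seteqP; split; last by move=> _ [M _ <-]; exact: Te'.
rewrite -{1}Tgen; apply: smallest_sub; first exact: range_mx_elt_TRO.
by move=> _ [x Zx <-]; rewrite rhoE//; exists (grid_coord x).
Qed.
End UniversalTRO.

(** As T^*(Z) is determined only up to isomorphism, the claim concerns every universal TRO; the
    existence half makes it non-vacuous. *)
Theorem mainTheorem3 (R : realType) (A : cstarAlgType R) (Z : set A) (n : nat)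
    (u : 'I_n -> 'I_n -> A)
    (Z_JCstar : is_JCstar_triple Z)
    (Z_findim : finite_dimensional Z)
    (u_grid : hermitian_grid (jordan_triple cstar_ternary) u Z)
    (u_span : Z = lin_span (fun ij : 'I_n * 'I_n => u ij.1 ij.2)) :
  (exists (H : hilbertType R) (T : set (H -> H)) (rho : A -> H -> H),
     is_universal_TRO Z T rho) /\
  (forall (H : hilbertType R) (T : set (H -> H)) (rho : A -> H -> H),
     is_universal_TRO Z T rho -> TRO_iso_matrices T n).
Proof.
split=> [|H T rho]; last first.
  exact: (universal_TRO_iso Z_JCstar u_grid u_span).
by do 3!eexists; exact: (grid_rep_universal Z_JCstar u_grid u_span).
Qed.
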